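(* (Local Fan Inequality.) Let $k\ge 2$, let $G=(V,E,\iota)$ be a finite multi-graph with maximum degree at most $k$, and let $\phi$ be a proper local partial colouring of $G$ with colours in $[k]$ that admits no improving Vizing chain. Let $e\in E$ be uncoloured by $\phi$, let $x\in e$, and let $F=(e_1,y_1,\dots,e_p,y_p)$ be a multi-fan at $x$ with respect to $e$ and $\phi$. Then: (a) For every $i\in[p]$ there exist $m\ge0$ and indices $i_0>i_1>\dots>i_m$ with $i_0=i$, $i_m=1$, such that $(e_{i_m},e_{i_{m-1}},\dots,e_{i_0})$ is a $\phi$-safe $\phi$-chain. (b) For every $i\in[p]$, $A_\phi(x)\cap A_\phi(y_i)\cap[\max\{d(x)+\pi(x),\,d(y_i)+\pi(y_i)\}]=\emptyset$. (c) For all $i\in[p]$, $\alpha\in\tilde A_\phi(x)$ and $\beta\in\tilde A_\phi(y_i)$, the path $P_\phi(y_i,\alpha,\beta)$ ends at $x$. (d) For all $i,j\in[p]$ with $y_i\neq y_j$, $\tilde A_\phi(y_i)\cap\tilde A_\phi(y_j)=\emptyset$. (e) If the multi-fan $F$ is maximal (cannot be extended to a longer multi-fan at $x$ with respect to $e$ and $\phi$), then $|\{y_1,\dots,y_p\}|\ge2$ and $$\sum_{z\in V(F)}\Big(\pi_F(x,z)-\min\{k,\,d(z)+\pi(z)\}+d_\phi(z)\Big)\ge1,$$ where $V(F)=\{y_1,\dots,y_p\}$, $\pi_F(x,z)=|\{i\in[p]: y_i=z\}|$ is the multiplicity of $xz$ among $e_1,\dots,e_p$, and $d_\phi(z)$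 is the number of coloured edges at $z$.
   Context: A multi-graph $G=(V,E,\iota)$ has a map $\iota:E\to\binom V2$ giving each edge its two distinct end-points; $e=xy$ means $\iota(e)=\{x,y\}$, and $x\in e$ means $x\in\iota(e)$. $\pi(x,y)$ is the number of edges with end-points $x,y$; $d(x)=\sum_{y\ne x}\pi(x,y)$; $\pi(x)=\max_{y\neq x}\pi(x,y)$; $[n]=\{1,\dots,n\}$, $[a,b]=\{a,\dots,b\}$. A partial colouring is a function $\phi$ from $\mathrm{dom}(\phi)\subseteq E$ to $[k]$; it is proper if no two distinct coloured edges sharing a vertex get the same colour, and local if every coloured edge $e$ has an end-point $x$ with $\phi(e)\le d(x)+\pi(x)$. $A_\phi(x)=[k]\setminus\{\phi(f): f\ni x, f\in\mathrm{dom}(\phi)\}$, $\tilde A_\phi(x)=A_\phi(x)\cap[d(x)+\pi(x)]$, and the potential is $\Phi(\phi)=\sum_{x\in V}|\tilde A_\phi(x)|$. A $\phi$-chain is a sequence of distinct edges $C=(e_1,\dots,e_p)$ such that $e_1$ is the only uncoloured edge among them and consecutive edges $e_i,e_{i+1}$ share exactly one vertex. The $C$-shift of $\phi$ is the partial colouring $\phi'$ with domain $(\mathrm{dom}(\phi)\setminus\{e_p\})\cup\{e_1\}$ agreeing with $\phi$ except $\phi'(e_i)=\phi(e_{i+1})$ for $i\in[p-1]$ ($e_p$ becomes uncoloured). A chain $(e,e')$ with $e=xy$, $e'=xz$ is $\phi$-safe if $\phi(e')\le d(y)+\pi(y)$ and no edge at $y$ has colour $\phi(e')$. A chain $(e_1,\dots,e_m)$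 with $m\ge3$ is $\phi$-safe if for every $i\in[m-1]$ the chain $(e_i,e_{i+1})$ is $\phi_i$-safe, where $\phi_i$ is the $(e_1,\dots,e_i)$-shift of $\phi$ (with the one-edge chain $(e_1)$ regarded as safe and its shift equal to $\phi$). A chain $C=(e_1,\dots,e_p)$ is improving if it is $\phi$-safe and either the $C$-shift $\phi'$ satisfies $\Phi(\phi')<\Phi(\phi)$, or $\phi'$ can be extended by colouring $e_p$ so that it remains proper and local. A chain is Vizing if it starts with edges $f_1,\dots,f_q$ ($q\ge1$) all containing a common vertex $z$, and then continues with a (possibly empty) initial segment of a bichromatic path starting at $y$, where $y\ne z$ is the other end-point of $f_q$. For a vertex $v$ and distinct colours $\alpha,\beta$ with $\beta$ missing at $v$, $P_\phi(v,\alpha,\beta)$ denotes the sequence of edges of the maximal path starting at $v$ whose edges are coloured alternately $\alpha,\beta,\alpha,\dots$ (starting with $\alpha$); it is empty if $\alpha$ is missing at $v$. A multi-fan at $x$ with respect to an uncoloured edge $e\ni x$ and $\phi$ is a sequence $F=(e_1,y_1,\dots,e_p,y_p)$, $p\ge1$, where $e_1,\dots,e_p$ are distinct edges, $e_1=e$, $e_i=xy_i$ for all $i\in[p]$, and for every $i\in[2,p]$ there is $j\in[i-1]$ with $\phi(e_i)\in\tilde A_\phi(y_j)$ (in particular $e_i$ is coloured). *)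

(* Defs.v *)
From mathcomp Require Import all_boot all_order all_algebra.

Set Implicit Arguments.
Unset Strict Implicit.
Unset Printing Implicit Defensive.

Record multigraph := Multigraph {
  vertex : finType;
  edge : finType;
  ends : edge -> {set vertex};
  card_ends : forall e : edge, #|ends e| = 2
}.

Section Multigraph.
Variable G : multigraph.
Implicit Types (x y z v : vertex G) (e f : edge G).

Definition mult x y : nat := #|[set e | ends e == [set x; y]]|.
Definition deg x : nat := \sum_(y | y != x) mult x y.
Definition maxmult x : nat := \max_(y | y != x) mult x y.

(* The other end-point of e when v \in ends e. *)
Definition opposite v e : vertex G := odflt v [pick w in ends e | w != v].

Fixpoint walk v (s : seq (edge G)) : bool :=
  if s is e :: s' then (v \in ends e) && walk (opposite v e) s' else true.

(* Vertices are pairwise distinct; v :: scanl opposite v s lists them. *)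
Definition is_path v (s : seq (edge G)) : bool :=
  walk v s && uniq (v :: scanl opposite v s).

Definition path_end v (s : seq (edge G)) : vertex G := foldl opposite v s.

End Multigraph.

(* The element c of 'I_k stands for the colour c + 1 of [k] = {1, ..., k};
   None means uncoloured. *)
Definition colouring (G : multigraph) (k : nat) := {ffun edge G -> option 'I_k}.

(* The set [m] of colours, restricted to [k]: c + 1 <= m. *)
Definition upto (k m : nat) : {set 'I_k} := [set c : 'I_k | c.+1 <= m].

Section Colouring.
Variables (G : multigraph) (k : nat).
Implicit Types (phi : colouring G k) (x y z v : vertex G) (e f : edge G).
Implicit Types (C s : seq (edge G)).

Definition proper_colouring phi : Prop :=
  forall e f x, e <> f -> x \in ends e -> x \in ends f ->
    phi e <> None -> phi e <> phi f.

Definition local_colouring phi : Prop :=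
  forall e c, phi e = Some c ->
    exists2 x, x \in ends e & c \in upto k (deg x + maxmult x).

Definition avail phi x : {set 'I_k} :=
  [set c | [forall f, (x \in ends f) ==> (phi f != Some c)]].

Definition tavail phi x : {set 'I_k} :=
  avail phi x :&: upto k (deg x + maxmult x).

Definition potential phi : nat := \sum_(x : vertex G) #|tavail phi x|.

Definition coldeg phi x : nat :=
  #|[set f : edge G | (x \in ends f) && (phi f != None)]|.

Definition chain phi C : Prop :=
  [/\ uniq C,
      exists e C', [/\ C = e :: C', phi e = None
                     & forall f, f \in C' -> phi f <> None]
    & forall C1 e e' C2, C = C1 ++ e :: e' :: C2 ->
        #|ends e :&: ends e'| = 1].

(* Each edge of C takes the colour of its successor in C; the last edge takes
   the default None. *)
Definition shift phi C : colouring G k :=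
  [ffun f => if f \in C then nth None [seq phi e | e <- C] (index f C).+1
             else phi f].

(* For e = xy and e' = xz with y \notin e'; membership of c in tavail phi y says
   that c is at most d(y) + pi(y) and is not used at y. *)
Definition safe_pair phi e e' : Prop :=
  exists y c, [/\ y \in ends e, y \notin ends e', phi e' = Some c
                & c \in tavail phi y].

(* With C1 and e the first i edges of C, shift phi (rcons C1 e) is phi_i.
   For one edge the second condition is void, and for two edges phi_1 = phi. *)
Definition safe phi C : Prop :=
  chain phi C /\
  forall C1 e e' C2, C = C1 ++ e :: e' :: C2 ->
    safe_pair (shift phi (rcons C1 e)) e e'.

Definition set_colour phi e (c : 'I_k) : colouring G k :=
  [ffun f => if f == e then Some c else phi f].

Definition improving phi C : Prop :=
  safe phi C /\
  (potential (shift phi C) < potential phi \/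
   exists C' e c, [/\ C = rcons C' e,
     proper_colouring (set_colour (shift phi C) e c)
     & local_colouring (set_colour (shift phi C) e c)]).

Fixpoint alternating phi (a b : 'I_k) s : bool :=
  if s is e :: s' then (phi e == Some a) && alternating phi b a s' else true.

Definition bichromatic_path phi v (a b : 'I_k) s : bool :=
  is_path v s && alternating phi a b s.

(* Here fs and f are f_1, ..., f_q, and opposite z f is the vertex y. *)
Definition vizing phi C : Prop :=
  chain phi C /\
  exists z fs f gs,
    [/\ C = rcons fs f ++ gs,
        forall g, g \in rcons fs f -> z \in ends g
      & exists a b s, [/\ a != b, bichromatic_path phi (opposite z f) a b s
                        & prefix gs s]].

(* s is P_phi(v, a, b). *)
Definition is_maxpath phi v (a b : 'I_k) s : Prop :=
  bichromatic_path phi v a b s /\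
  forall f, ~~ bichromatic_path phi v a b (rcons s f).

Definition multifan phi x e (F : seq (edge G * vertex G)) : Prop :=
  [/\ ohead (unzip1 F) = Some e,
      uniq (unzip1 F),
      forall f y, (f, y) \in F -> ends f = [set x; y]
    & forall i, 0 < i < size F ->
        exists j c, [/\ j < i, phi (nth e (unzip1 F) i) = Some c
                      & c \in tavail phi (nth x (unzip2 F) j)]].

Definition maximal_multifan phi x e (F : seq (edge G * vertex G)) : Prop :=
  multifan phi x e F /\
  forall F', multifan phi x e F' -> prefix F F' -> F' = F.

Definition fan_vertices (F : seq (edge G * vertex G)) : {set vertex G} :=
  [set z in unzip2 F].

Lemma bichromatic_path_rcons phi v a b s f :
  bichromatic_path phi v a b (rcons s f) -> bichromatic_path phi v a b s.
Proof.
rewrite /bichromatic_path /is_path -cats1 scanl_cat -cat_cons cat_uniq.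
move=> /andP[/andP[W /andP[-> _]] A]; rewrite andbT.
apply/andP; split.
  elim: s v W {A} => //= g s IH v /andP[-> W]; exact: IH.
elim: s a b A {W} => //= g s IH a b /andP[-> A]; exact: IH.
Qed.

Lemma is_maxpath_exists phi v a b : exists s, is_maxpath phi v a b s.
Proof.
have bound s : bichromatic_path phi v a b s -> size s < #|vertex G|.
  case/andP=> /andP[_ U] _.
  by move: (card_uniqP U) (max_card [in v :: scanl (@opposite G) v s]);
    rewrite /= size_scanl => ->.
suff main n s : bichromatic_path phi v a b s -> #|vertex G| - size s <= n ->
    exists s, is_maxpath phi v a b s.
  by apply: (main #|vertex G| [::]) => //; rewrite subn0.
elim: n s => [|n IH] s Ps.
  by rewrite leqn0 subn_eq0 leqNgt bound.
move=> le_n.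
have [/existsP[f Pf]|/existsPn no] :=
  boolP [exists f, bichromatic_path phi v a b (rcons s f)]; last by exists s.
apply: (IH _ Pf); rewrite size_rcons subnS.
by case: (_ - _) le_n.
Qed.

Lemma is_maxpath_unique phi v a b s t :
  proper_colouring phi -> is_maxpath phi v a b s -> is_maxpath phi v a b t ->
  s = t.
Proof.
move=> prop.
have det s1 s2 w c d : walk w s1 -> walk w s2 ->
    alternating phi c d s1 -> alternating phi c d s2 ->
    prefix s1 s2 \/ prefix s2 s1.
  elim: s1 s2 w c d => [|e s1 IH] [|f s2] w c d /=; [by left..|by right|].
  move=> /andP[we W1] /andP[wf W2] /andP[/eqP pe A1] /andP[/eqP pf A2].
  have [ef|/eqP nef] := eqVneq e f.
    by subst f; apply: IH W1 W2 A1 A2.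
  by case: (prop e f w nef we wf); rewrite pe ?pf.
have pre s1 s2 : is_maxpath phi v a b s1 -> is_maxpath phi v a b s2 ->
    prefix s1 s2 -> s1 = s2.
  move=> [_ max1] [P2 _] /prefixP[r]; case: r => [|f r E]; first by rewrite cats0.
  case/negP: (max1 f); move: P2; rewrite E -cat_rcons => {E}.
  elim/last_ind: r => [|r g IH]; first by rewrite cats0.
  by rewrite -rcons_cat => /bichromatic_path_rcons.
move=> Ms Mt; have [/andP[/andP[Ws _] As] _] := Ms.
have [/andP[/andP[Wt _] At] _] := Mt.
by case: (det _ _ _ _ _ Ws Wt As At) => [/(pre _ _ Ms Mt)|/(pre _ _ Mt Ms)].
Qed.

End Colouring.

(* Main.v *)
Require Import Defs.
From mathcomp Require Import all_boot all_order all_algebra zify.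

(* Every safe single shift moves a colour c from an edge vw to an edge uv; the
   potential drops by one at u and grows by at most one, at w.  Hence, if no
   chain is improving, c is at most d(w) + pi(w), and this bound at w is just
   what makes the shift after the next one along a bichromatic path safe.
   Consequently, shifting along the whole path P(y_i, alpha, beta) after a fan
   chain would succeed, unless that path ends at x; this gives (c).  The paths
   P(y_i, alpha, beta) and P(y_j, alpha, beta) are then both the reverse of the
   path from x, so y_i = y_j, which is (d).  For (e), the disjoint sets of
   missing colours at the fan vertices all appear, by (b) and maximality, on the
   p - 1 coloured edges of the fan. *)

Set Implicit Arguments.
Unset Strict Implicit.
Unset Printing Implicit Defensive.

(** * End-points and paths *)

Section Endpoints.
Variable G : multigraph.
Implicit Types (u v w x y : vertex G) (e f g : edge G) (s : seq (edge G)).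

Lemma opposite_spec v e :
  v \in ends e -> opposite v e != v /\ ends e = [set v; opposite v e].
Proof.
move=> ve; rewrite /opposite; case: pickP => [w /= /andP[we nwv]|no].
  split=> //; apply/esym/eqP; rewrite eqEcard card_ends cards2 eq_sym nwv andbT.
  by apply/subsetP=> z; rewrite !inE => /orP[]/eqP->.
have: #|ends e :\ v| = 1 by have := cardsD1 v (ends e); rewrite ve card_ends => -[].
case/eqP/cards1P=> w Ew; have := no w; have := set11 w.
by rewrite -Ew !inE => /andP[-> ->].
Qed.

Lemma opposite_neq v e : v \in ends e -> opposite v e != v.
Proof. by case/opposite_spec. Qed.

Lemma ends_opposite v e : v \in ends e -> ends e = [set v; opposite v e].
Proof. by case/opposite_spec. Qed.

Lemma opposite_in v e : v \in ends e -> opposite v e \in ends e.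
Proof. by move=> /ends_opposite E; rewrite E !inE eqxx orbT. Qed.

Lemma ends_neq v w e : ends e = [set v; w] -> v != w.
Proof. by move=> E; have := card_ends e; rewrite E cards2; case: eqP. Qed.

Lemma opposite_ends v w e : ends e = [set v; w] -> opposite v e = w.
Proof.
move=> E; have ve : v \in ends e by rewrite E !inE eqxx.
have := opposite_in ve; have := opposite_neq ve.
by rewrite E !inE => /negbTE-> /eqP.
Qed.

Lemma oppositeK v e : v \in ends e -> opposite (opposite v e) e = v.
Proof. by move=> /ends_opposite; rewrite setUC => /opposite_ends. Qed.

Lemma card_incident x : #|[set f : edge G | x \in ends f]| <= deg x.
Proof.
rewrite -sum1_card (partition_big (fun f => opposite x f) (fun y => y != x)) /=.
  apply: leq_sum => y _; rewrite sum1_card subset_leq_card //.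
  apply/subsetP=> f; rewrite unfold_in !inE /= => /andP[xf /eqP<-].
  by rewrite -ends_opposite.
by move=> f; rewrite inE => /opposite_neq.
Qed.

Lemma path_end_last v s : path_end v s = last v (scanl (@opposite G) v s).
Proof. by elim: s v => //= e s IH v; rewrite /path_end /= -IH. Qed.

Lemma path_end_mem v s : path_end v s \in v :: scanl (@opposite G) v s.
Proof. by rewrite path_end_last mem_last. Qed.

Lemma is_path_cons v e s :
  is_path v (e :: s) =
  [&& v \in ends e, is_path (opposite v e) s
    & v \notin opposite v e :: scanl (@opposite G) (opposite v e) s].
Proof.
rewrite /is_path /=; case: (v \in ends e) => //=.
by rewrite -!andbA; do !bool_congr.
Qed.

Lemma mem_walk v s e w :
  walk v s -> e \in s -> w \in ends e -> w \in v :: scanl (@opposite G) v s.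
Proof.
elim: s v => //= g s IH v /andP[vg W]; rewrite inE => /orP[/eqP->|es we].
  by rewrite (ends_opposite vg) !inE => /orP[]->; rewrite ?orbT.
by rewrite inE (IH _ W es we) orbT.
Qed.

Lemma is_path_end_start v s : is_path v s -> path_end v s = v -> s = [::].
Proof.
case: s => // e s; rewrite is_path_cons => /and3P[_ _ nv] E.
by move: nv; rewrite -{1}E /path_end /= -/(path_end _ _) path_end_mem.
Qed.

(** Induction on the walk. The equation between vertex lists is what carries distinctness of the
    vertices over to the reversed walk. *)
Lemma path_end_rev v s :
  walk v s -> walk (path_end v s) (rev s) /\
    (path_end (path_end v s) (rev s) = v) /\
    (path_end v s :: scanl (@opposite G) (path_end v s) (rev s) =
      rev (v :: scanl (@opposite G) v s)).
Proof.
elim: s v => [//|e s IH] v /andP[ve W].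
have [W' [E S]] := IH _ W.
have -> : path_end v (e :: s) = path_end (opposite v e) s by [].
have wcat t t' z : walk z (t ++ t') = walk z t && walk (path_end z t) t'.
  by elim: t z => //= h t IHt z; rewrite IHt andbA.
rewrite !rev_cons -!cats1 wcat W' E [walk _ [:: _]]/= opposite_in //; split=> //.
split; first by rewrite /path_end foldl_cat -/(path_end _ (rev s)) E /= oppositeK.
rewrite scanl_cat -cat_cons S -/(path_end _ (rev s)) E /=.
by rewrite oppositeK // rev_cons -cats1.
Qed.

End Endpoints.

(** * Colours available at a vertex *)

Section Colourings.
Variables (G : multigraph) (k : nat).
Implicit Types (phi psi : colouring G k) (u v w x y z : vertex G).
Implicit Types (e f g h : edge G) (C s : seq (edge G)) (a b c : 'I_k).

Lemma availP phi x c :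
  reflect (forall f, x \in ends f -> phi f <> Some c) (c \in avail phi x).
Proof.
rewrite inE; apply: (iffP forallP) => H f; first by move=> xf; apply/eqP/(implyP (H f)).
by apply/implyP=> /H/eqP.
Qed.

Lemma tavailP phi x c :
  reflect (c \in avail phi x /\ c \in upto k (deg x + maxmult x))
          (c \in tavail phi x).
Proof. by rewrite in_setI; apply: andP. Qed.

Lemma proper_inj phi e f x c : proper_colouring phi ->
  x \in ends e -> x \in ends f -> phi e = Some c -> phi f = Some c -> e = f.
Proof.
move=> P xe xf pe pf; apply/eqP/negP=> /negP/eqP nef.
by case: (P e f x nef xe xf); rewrite pe ?pf.
Qed.

Lemma not_availP phi x c :
  c \notin avail phi x -> exists2 f, x \in ends f & phi f = Some c.
Proof.
rewrite inE negb_forall => /existsP[f]; rewrite negb_imply negbK.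
by case/andP=> xf /eqP; exists f.
Qed.

Lemma card_upto m : #|upto k m| = minn k m.
Proof.
rewrite -sum1_card (eq_bigl (fun c : 'I_k => c < m)); last by move=> c; rewrite inE.
have [le_km|/ltnW le_mk] := leqP k m.
  rewrite (eq_bigl xpredT) ?sum1_card ?card_ord // => c.
  exact: leq_trans (ltn_ord c) le_km.
by rewrite -(big_ord_widen k (fun=> 1) le_mk) sum1_card card_ord.
Qed.

(** * Shifting along a chain *)

(** This is the shift along the two-edge chain [(e, g)], isolated so that longer shifts can be built
    from it one edge at a time. *)
Definition step psi e g : colouring G k :=
  [ffun f => if f == e then psi g else if f == g then None else psi f].

Lemma shift1 phi e : phi e = None -> shift phi [:: e] = phi.
Proof.
move=> pe; apply/ffunP=> f; rewrite ffunE inE; case: eqP => // ->.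
by rewrite /= eqxx pe.
Qed.

Lemma shift_out phi C f : f \notin C -> shift phi C f = phi f.
Proof. by rewrite ffunE => /negbTE->. Qed.

(** Appending [g] changes the successor of no earlier edge except [e]. Before, [e] was last and took
    the default [None]; now it takes the colour of [g], and [g] takes the default. *)
Lemma shift_rcons phi C e g : uniq (rcons (rcons C e) g) ->
  shift phi (rcons (rcons C e) g) = step (shift phi (rcons C e)) e g.
Proof.
move=> U; apply/ffunP=> f; rewrite ffunE [in RHS]ffunE.
move: U; rewrite rcons_uniq => /andP[ng U].
rewrite mem_rcons inE; have [->|nfg] := eqVneq f g.
  have nge : g != e by apply: contraNneq ng => ->; rewrite mem_rcons mem_head.
  rewrite (negbTE nge) nth_default // size_map size_rcons ltnS.
  by rewrite -[rcons _ g]cats1 index_cat (negbTE ng) leq_addr.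
rewrite (shift_out _ ng) /=.
have [->|nfe] := eqVneq f e.
  rewrite mem_rcons mem_head -[rcons (rcons C e) g]cats1 index_cat.
  rewrite mem_rcons mem_head map_cat nth_cat size_map size_rcons.
  rewrite -cats1 index_cat.
  move: U; rewrite rcons_uniq => /andP[/negbTE-> _] /=.
  by rewrite eqxx addn0 ltnn subnn.
rewrite ffunE; case: ifP => // fC.
rewrite -[rcons (rcons C e) g]cats1 index_cat fC map_cat nth_cat size_map.
suff -> : (index f (rcons C e)).+1 < size (rcons C e) by [].
have fC' : f \in C by move: fC; rewrite mem_rcons inE (negbTE nfe).
by rewrite size_rcons ltnS -cats1 index_cat fC' index_mem.
Qed.

(** * A single safe shift, from an edge [vw] to an edge [uv] *)

Section Step.
Variables (psi : colouring G k) (e g : edge G) (u v w : vertex G) (c : 'I_k).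
Hypotheses (ends_e : ends e = [set u; v]) (ends_g : ends g = [set v; w]).
Hypotheses (neq_uw : u != w) (psi_e : psi e = None) (psi_g : psi g = Some c).
Hypotheses (c_u : c \in tavail psi u) (P : proper_colouring psi).

Let neq_vw : v != w := ends_neq ends_g.

(** At [u] the colour [c] is missing, and at [v] only [g] carries it, so [e] may take it once [g]
    gives it up. *)
Lemma step_proper : proper_colouring (step psi e g).
Proof.
have c_av := c_u; case/tavailP: c_av => /availP c_av _.
have vg : v \in ends g by rewrite ends_g !inE eqxx.
have key f x : f <> e -> f <> g -> x \in ends e -> x \in ends f ->
    psi f <> Some c.
  move=> fe fg; rewrite ends_e !inE => /orP[]/eqP-> xf; first exact: c_av.
  by move=> pf; case: fg; apply: (proper_inj P xf vg pf).
move=> f f' x nff' xf xf'; rewrite 2!ffunE.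
have [E|/eqP nfe] := eqVneq f e.
  subst f; have [//|/eqP nf'e] := eqVneq f' e; first by move=> E; case: nff'.
  rewrite psi_g; have [_//|/eqP nf'g] := eqVneq f' g.
  by move=> _ /esym; apply: key xf xf'.
have [_//|/eqP nfg] := eqVneq f g.
have [E|/eqP nf'e] := eqVneq f' e; first by subst f'; rewrite psi_g => _; apply: key xf' xf.
by have [_//|/eqP nf'g] := eqVneq f' g; exact: P xf xf'.
Qed.

Lemma step_local : local_colouring psi -> local_colouring (step psi e g).
Proof.
move=> L f d; rewrite ffunE; have [->|_] := eqVneq f e.
  rewrite psi_g => -[<-]; exists u; first by rewrite ends_e !inE eqxx.
  by case/tavailP: c_u.
by have [//|_] := eqVneq f g; apply: L.
Qed.

Lemma step_avail_sub d z : z \notin ends e ->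
  d \in avail psi z -> d \in avail (step psi e g) z.
Proof.
move=> ze /availP H; apply/availP=> f zf; rewrite ffunE.
have [E|_] := eqVneq f e; first by move: ze; rewrite -E zf.
by have [//|_] := eqVneq f g; apply: H.
Qed.

Lemma step_avail_shared (d : 'I_k) : d != c ->
  d \in avail psi v -> d \in avail (step psi e g) v.
Proof.
move=> dc /availP H; apply/availP=> f zf; rewrite ffunE.
have [E|_] := eqVneq f e; first by rewrite psi_g => -[E']; rewrite E' eqxx in dc.
by have [//|_] := eqVneq f g; apply: H.
Qed.

Lemma step_avail_new : c \in avail (step psi e g) w.
Proof.
have we : w \notin ends e.
  by rewrite ends_e !inE negb_or [w == u]eq_sym [w == v]eq_sym neq_uw neq_vw.
have wg : w \in ends g by rewrite ends_g !inE eqxx orbT.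
apply/availP=> f wf; rewrite ffunE.
have [E|_] := eqVneq f e; first by move: we; rewrite -E wf.
have [//|nfg pf] := eqVneq f g.
by case/eqP: nfg; apply: (proper_inj P wf wg pf).
Qed.

(** A colour can be freed only by uncolouring [g], hence only at [v] or [w]; at [v] the colour [c]
    reappears on [e]. *)
Lemma step_avail_inv d z : d \in avail (step psi e g) z ->
  d \in avail psi z \/ (d = c /\ z = w).
Proof.
move=> /availP H; have [|/not_availP[f zf pf]] := boolP (d \in avail psi z); first by left.
have := H _ zf; rewrite ffunE.
have [E|_] := eqVneq f e; first by move: pf; rewrite E psi_e.
have [E _|_] := eqVneq f g; last by rewrite pf.
right; subst f; move: pf; rewrite psi_g => -[E]; split=> //.
move: zf; rewrite ends_g !inE => /orP[/eqP Ez|/eqP//].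
have /H : z \in ends e by rewrite Ez ends_e !inE eqxx orbT.
by rewrite ffunE eqxx psi_g E.
Qed.

(* Only [u], which loses the colour [c], and [w], which gains it, matter. *)
Lemma step_potential :
  potential (step psi e g) + (c \notin upto k (deg w + maxmult w)) <= potential psi.
Proof.
set psi' := step psi e g.
have Hz z : z != w -> tavail psi' z \subset tavail psi z.
  move=> zw; apply/subsetP=> d /tavailP[/step_avail_inv[dz|[_ E]] du].
    exact/tavailP.
  by rewrite E eqxx in zw.
have Hu : tavail psi' u \subset tavail psi u :\ c.
  apply/subsetP=> d du; rewrite in_setD1 (subsetP (Hz _ neq_uw)) // andbT.
  apply/eqP=> E; case/tavailP: du => /availP/(_ e); rewrite ends_e !inE eqxx.
  by move=> /(_ isT); rewrite ffunE eqxx psi_g E.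
have Hw : #|tavail psi' w| + (c \notin upto k (deg w + maxmult w)) <= #|tavail psi w|.+1.
  case: (boolP (c \in _)) => cw /=.
    rewrite addn0 -add1n; have := leq_card_setU [set c] (tavail psi w).
    rewrite cards1; case=> L _; apply: leq_trans (L); apply: subset_leq_card.
    apply/subsetP=> d /tavailP[/step_avail_inv[dw|[-> _]] du]; rewrite !inE ?eqxx //.
    by move: dw du; rewrite /tavail !inE => -> ->; rewrite orbT.
  rewrite addn1 ltnS; apply/subset_leq_card/subsetP=> d /tavailP[/step_avail_inv[dw|[-> _]] du].
    exact/tavailP.
  by rewrite du in cw.
have neq_wu : w != u by rewrite eq_sym.
have split_uw (chi : colouring G k) : potential chi = #|tavail chi u| +
    (#|tavail chi w| + \sum_(i | (i != u) && (i != w)) #|tavail chi i|).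
  by rewrite /potential (bigD1 u) //= (bigD1 w).
rewrite !split_uw.
have L1 := subset_leq_card Hu; have := cardsD1 c (tavail psi u); rewrite c_u add1n => L2.
have L3 : \sum_(i | (i != u) && (i != w)) #|tavail psi' i| <=
    \sum_(i | (i != u) && (i != w)) #|tavail psi i|.
  by apply: leq_sum => z /andP[_ zw]; apply/subset_leq_card/Hz.
move: L1 L2 L3 Hw; move: (tavail psi u :\ c) => A.
move: (nat_of_bool _) #|A| #|tavail psi u| #|tavail psi' u| #|tavail psi w| #|tavail psi' w|.
move: (\sum_(i | _) _) (\sum_(i | _) _); lia.
Qed.

End Step.

(** * Safe chains and their shifts *)

(** The conditions in [chain] and [safe] quantify over consecutive pairs; this separates the pair
    created by a new last edge from the old ones. *)
Lemma rcons2_split (T : Type) (C C1 C2 : seq T) (e g e1 e2 : T) :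
  rcons (rcons C e) g = C1 ++ e1 :: e2 :: C2 ->
  [/\ C1 = C, e1 = e & e2 = g] \/ exists r, rcons C e = C1 ++ e1 :: e2 :: r.
Proof.
case/lastP: C2 => [|C2 h].
  rewrite -cat_rcons cats1 => /rcons_inj[E ->].
  by case/rcons_inj: E => -> ->; left.
by rewrite -!rcons_cons -rcons_cat => /rcons_inj[-> _]; right; exists C2.
Qed.

(** Makes safety amenable to induction on the last edge, in parallel with [shift_rcons]. *)
Lemma safe_rcons phi C e g :
  safe phi (rcons (rcons C e) g) <->
  [/\ safe phi (rcons C e), g \notin rcons C e, phi g <> None,
      #|ends e :&: ends g| = 1 & safe_pair (shift phi (rcons C e)) e g].
Proof.
split.
  move=> [[U [e0 [C' [E0 pe0 pC']]] cap] S].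
  move: (U); rewrite rcons_uniq => /andP[ng UC].
  have E1 : rcons (rcons C e) g = C ++ [:: e, g & [::]] by rewrite -!cats1 -catA.
  split; [|done| |exact: cap E1|exact: S E1].
    split; last by move=> C1 e1 e2 C2 E; apply: (S _ _ _ (rcons C2 g)); rewrite E rcons_cat.
    split; first done; last first.
      by move=> C1 e1 e2 C2 E; apply: (cap C1 _ _ (rcons C2 g)); rewrite E rcons_cat.
    case: C E0 {E1 U ng UC cap S} => [|e1 C] /= [-> E0].
      by exists e0, [::]; split.
    exists e0, (rcons C e); split=> // f fC; apply: pC'.
    by rewrite -E0 mem_rcons inE fC orbT.
  by apply: pC'; case: C E0 {E1 U ng UC cap S} => [|e1 C] /= [_ <-]; rewrite ?mem_rcons mem_head.
move=> [[[U [e0 [C' [E0 pe0 pC']]] cap] S] ng pg capg Sg].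
split.
  split; first by rewrite rcons_uniq ng.
    exists e0, (rcons C' g); rewrite E0; split=> // f.
    by rewrite mem_rcons inE => /orP[/eqP->//|]; apply: pC'.
  by move=> C1 e1 e2 C2 E; have [[_ -> ->]|[r Er]] := rcons2_split E; [|exact: cap Er].
by move=> C1 e1 e2 C2 E; have [[-> -> ->]|[r Er]] := rcons2_split E; [|exact: S Er].
Qed.

Lemma safe1 phi e : phi e = None -> safe phi [:: e].
Proof.
move=> pe; split; last by move=> [|? []].
by split=> [//||[|? []]//]; exists e, [::].
Qed.

(** Brings a safe pair into the normal form assumed by the facts on [step]: the end [u] of [e] lies
    off [g], so the shared vertex is the other end of [e]. *)
Lemma safe_pair_ends psi e g : #|ends e :&: ends g| = 1 -> safe_pair psi e g ->
  exists u v w c, [/\ ends e = [set u; v], ends g = [set v; w], u != w,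
    psi g = Some c & c \in tavail psi u].
Proof.
move=> /eqP/cards1P[v Ev] [u [c [ue ug pg cu]]].
have : v \in ends e :&: ends g by rewrite Ev set11.
rewrite inE => /andP[ve vg].
have nuv : v != u by apply: contraNneq ug => <-.
have Eu : ends e = [set u; v].
  have Ee := ends_opposite ue; move: ve; rewrite Ee !inE (negbTE nuv) /=.
  by move=> /eqP->.
exists u, v, (opposite v g), c; split=> //; first exact: ends_opposite.
by apply: contraNneq ug => ->; apply: opposite_in.
Qed.

(** Induction on the chain, each new edge being one safe [step]. The bound on the potential ensures
    that a strict drop at a later step is a drop below the potential of [phi] itself. *)
Lemma safe_shift phi C e : proper_colouring phi -> local_colouring phi ->
  safe phi (rcons C e) ->
  [/\ proper_colouring (shift phi (rcons C e)),
      local_colouring (shift phi (rcons C e)),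
      potential (shift phi (rcons C e)) <= potential phi
    & shift phi (rcons C e) e = None].
Proof.
move=> P L; elim/last_ind: C e => [|C e IH] g S.
  have pg : phi g = None by case: S => [[_ [e0 [C' [[->]]]]]].
  by rewrite /= shift1.
have [[U _ _] _] := S; rewrite shift_rcons //.
have /safe_rcons[/IH[P' L' po' pe'] ng _ cap Sg] := S.
have [u [v [w [c [Ee Eg nuw pg cu]]]]] := safe_pair_ends cap Sg.
split; first exact: (step_proper Ee Eg pg cu P').
- exact: (step_local Ee pg cu L').
- apply: leq_trans po'; have := step_potential Ee Eg nuw pe' pg cu.
  by apply: leq_trans; apply: leq_addr.
rewrite ffunE eqxx; case: eqP => // E; move: ng.
by rewrite E mem_rcons mem_head.
Qed.

(** * Two ways to obtain an improving chain *)

(** The last edge can receive [c]: properness holds because [c] is missing at both ends, and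
    locality because the maximum is attained at one of them. *)
Lemma improving_colour phi C e u v c :
  proper_colouring phi -> local_colouring phi -> safe phi (rcons C e) ->
  ends e = [set u; v] ->
  c \in avail (shift phi (rcons C e)) u -> c \in avail (shift phi (rcons C e)) v ->
  c \in upto k (maxn (deg u + maxmult u) (deg v + maxmult v)) ->
  improving phi (rcons C e).
Proof.
move=> P L S Ee; have [] := safe_shift P L S.
set psi := shift _ _ => P' L' _ _ /availP cu /availP cv c_max.
split=> //; right; exists C, e, c; rewrite -/psi; split=> //.
  have key f x : x \in ends e -> x \in ends f -> psi f <> Some c.
    by rewrite Ee !inE => /orP[]/eqP->; [apply: cu|apply: cv].
  move=> f f' x nff' xf xf'; rewrite [set_colour _ _ _ f]ffunE [set_colour _ _ _ f']ffunE.
  have [E|nfe] := eqVneq f e; have [E'|nf'e] := eqVneq f' e.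
  - by case: nff'; rewrite E E'.
  - by move=> _ /esym; apply: (key f' x) => //; rewrite -E.
  - by move=> _; apply: (key f x) => //; rewrite -E'.
  exact: P' xf xf'.
move=> f d; rewrite ffunE; have [->|_] := eqVneq f e; last exact: L'.
move=> [<-]; move: c_max; rewrite inE leq_max => /orP[] le_c.
  by exists u; rewrite ?Ee !inE ?eqxx.
by exists v; rewrite ?Ee !inE ?eqxx ?orbT.
Qed.

(* A non-improving shift towards [w] forces the moved colour below
   [deg w + maxmult w], which is the bound that the next but one shift needs. *)
Lemma kempe_improving phi C e u v a b s :
  proper_colouring phi -> local_colouring phi -> safe phi (rcons C e) ->
  ends e = [set u; v] -> a != b -> bichromatic_path phi v a b s ->
  {in s, forall f, f \notin rcons C e} ->
  u \notin v :: scanl (@opposite G) v s ->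
  a \in tavail (shift phi (rcons C e)) u ->
  b \in tavail (shift phi (rcons C e)) v ->
  (if odd (size s) then b else a) \in
    avail (shift phi (rcons C e)) (path_end v s) ->
  exists t, improving phi (rcons C e ++ take t s).
Proof.
move=> P L; elim: s C e u v a b => [|g s IH] C e u v a b S Ee nab.
  (* The path is exhausted, so [v] is its end and [a] is missing at both ends of [e]. *)
  move=> _ _ _ /tavailP[au a_u] _ av; exists 0; rewrite cats0.
  apply: (improving_colour P L S Ee au av).
  by move: a_u; rewrite !inE leq_max => ->.
rewrite /bichromatic_path is_path_cons -andbA -andbA => /and5P[vg pth nv /eqP pg alt].
set w := opposite v g in pth nv *.
move=> out; rewrite inE negb_or /= -/w => /andP[nuv nu] a_u b_v c_end.
have [P' L' po' pe'] := safe_shift P L S.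
set psi := shift phi (rcons C e) in P' L' po' pe' a_u b_v c_end.
have ng : g \notin rcons C e by apply: out; rewrite mem_head.
have Eg : ends g = [set v; w] := ends_opposite vg.
have nuw : u != w by apply: contraNneq nu => ->; rewrite mem_head.
have pg' : psi g = Some a by rewrite /psi shift_out.
have Sg : safe phi (rcons (rcons C e) g).
  apply/safe_rcons; split=> //; first by rewrite pg.
    apply/eqP/cards1P; exists v; apply/setP=> z; rewrite Ee Eg !inE.
    case: eqVneq => [->|nzu] /=; last by case: eqVneq.
    by rewrite (negbTE nuv) (negbTE nuw).
  exists u, a; split=> //; first by rewrite Ee !inE eqxx.
  by rewrite Eg !inE (negbTE nuv) (negbTE nuw).
have [[U _ _] _] := Sg.
have Eshift := shift_rcons phi U; rewrite -/psi in Eshift.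
(* If [a] exceeds the bound at [w], the shift onto [g] alone already lowers the potential. *)
have [a_w|na_w] := boolP (a \in upto k (deg w + maxmult w)); last first.
  exists 1; rewrite /= take0 cats1; split=> //; left; rewrite Eshift.
  have := step_potential Ee Eg nuw pe' pg' a_u.
  by rewrite na_w addn1 => /leq_trans; apply.
have [t] : exists t, improving phi (rcons (rcons C e) g ++ take t s); last first.
  by rewrite cat_rcons; exists t.+1.
(* The uncoloured edge is now [g], with ends [v] and [w], and the colours swap roles: [b] stays
   available at [v] since only [a] moved, and [a] has become available at [w]. *)
apply: (IH _ _ v w b a) => //; rewrite ?Eshift.
- by rewrite eq_sym.
- by rewrite /bichromatic_path pth.
(* The edge [g] does not recur in [s], since it contains [v], which the path never revisits. *)
- move=> f fs; rewrite mem_rcons inE negb_or out ?inE ?fs ?orbT // andbT.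
  apply: contra nv => /eqP E; case/andP: pth => W _.
  by apply: mem_walk W _ vg; rewrite -E.
- case/tavailP: b_v => bv b_v; apply/tavailP; split=> //.
  by apply: (step_avail_shared e pg'); rewrite // eq_sym.
- by apply/tavailP; split=> //; apply: (step_avail_new Ee Eg nuw pg' P').
have -> : (if odd (size s) then a else b) = (if odd (size (g :: s)) then b else a).
  by rewrite /=; case: odd.
(* The end of the path is neither [u] nor [v], so colouring [e] takes no colour from it. *)
apply: step_avail_sub => //.
have Z := path_end_mem w s; rewrite Ee !inE negb_or.
by apply/andP; split; [apply: contraNneq nu => <-|apply: contraNneq nv => <-].
Qed.

(** * Maximal bichromatic paths *)

Lemma bichromatic_cons phi v a b e s :
  bichromatic_path phi v a b (e :: s) =
  [&& v \in ends e, phi e == Some a, bichromatic_path phi (opposite v e) b a s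
    & v \notin opposite v e :: scanl (@opposite G) (opposite v e) s].
Proof.
by rewrite /bichromatic_path is_path_cons /= -!andbA; do !bool_congr.
Qed.

(** The expression [if odd (size s) then b else a] is the colour due next: the path starts with [a],
    so [a] is due after an even number of edges. *)
Lemma bichromatic_rcons phi v a b s f :
  bichromatic_path phi v a b (rcons s f) =
  [&& bichromatic_path phi v a b s, path_end v s \in ends f,
      opposite (path_end v s) f \notin v :: scanl (@opposite G) v s
    & phi f == Some (if odd (size s) then b else a)].
Proof.
have walk_rcons : walk v (rcons s f) = walk v s && (path_end v s \in ends f).
  by elim: s v => [|g s IH] v; rewrite /= ?andbT // IH andbA.
have alt_rcons : alternating phi a b (rcons s f) =
    alternating phi a b s && (phi f == Some (if odd (size s) then b else a)).
  elim: s a b {walk_rcons} => [|g s IH] a b; rewrite /= ?andbT // IH andbA.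
  by case: (odd _).
rewrite /bichromatic_path /is_path walk_rcons alt_rcons -[rcons s f]cats1.
rewrite scanl_cat -cat_cons cats1 rcons_uniq -/(path_end v s).
by rewrite -!andbA; do !bool_congr.
Qed.

Lemma bichromatic_rev phi v a b s : bichromatic_path phi v a b s ->
  bichromatic_path phi (path_end v s) (if odd (size s) then a else b)
    (if odd (size s) then b else a) (rev s).
Proof.
case/andP=> /andP[W U] alt; have [W' [_ S]] := path_end_rev W.
rewrite /bichromatic_path /is_path W' S rev_uniq U /=.
elim: s a b alt {W U W' S} => //= e s IH a b /andP[/eqP pe /IH].
rewrite rev_cons -cats1 => {}IH.
have alt_cat t c d : alternating phi c d t ->
    phi e = Some (if odd (size t) then d else c) -> alternating phi c d (t ++ [:: e]).
  elim: t c d {IH} => [|g t IHt] c d /=; first by move=> _ ->; rewrite eqxx.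
  by case/andP=> -> alt pe'; apply: IHt alt _; rewrite pe'; case: odd.
apply: alt_cat; first by case: odd IH.
by rewrite size_rev pe; case: odd.
Qed.

(** An interior vertex lies on two consecutive edges of the path, one of each colour. *)
Lemma interior_not_avail phi v a b s x : bichromatic_path phi v a b s ->
  x \in v :: scanl (@opposite G) v s -> x != v -> x != path_end v s ->
  a \notin avail phi x /\ b \notin avail phi x.
Proof.
elim: s v a b => [|g s IH] v a b; first by rewrite inE => _ ->.
rewrite bichromatic_cons => /and4P[vg /eqP pg bi _].
rewrite inE => /orP[->//|] xs _ xe.
have [E|nxw] := eqVneq x (opposite v g); last first.
  by have [] := IH _ _ _ bi xs nxw xe.
subst x; case: s bi xe {IH xs} => [|h s]; first by rewrite /path_end /= eqxx.
rewrite bichromatic_cons => /and4P[wh /eqP ph _ _] _.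
split; apply/negP=> /availP; first by move/(_ g (opposite_in vg)).
by move/(_ h wh).
Qed.

(* An edge closing a cycle at [v] would have colour [a] or [b] there; the first
   colour is that of the first edge of the path, the second is missing. *)
Lemma maxpath_avail phi v a b s : proper_colouring phi -> a != b ->
  b \in avail phi v -> is_maxpath phi v a b s ->
  (if odd (size s) then b else a) \in avail phi (path_end v s).
Proof.
move=> P nab /availP bv [bi mx]; apply/negP=> /negP/not_availP[f zf pf].
(* Stated for arbitrary colours and start, because the induction removes the first edge and thereby
   swaps the colours. *)
have fresh c d u t : c != d -> bichromatic_path phi u c d t ->
    path_end u t \in ends f -> phi f = Some (if odd (size t) then d else c) ->
    ~ (u \in ends f /\ phi f = Some d) ->
    opposite (path_end u t) f \notin u :: scanl (@opposite G) u t.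
  elim: t c d u {zf pf} => [|g t IH] c d u ncd.
    by move=> _ uf _ _; rewrite inE; apply: opposite_neq.
  rewrite bichromatic_cons => /and4P[ug /eqP pg bi' nu].
  have -> : path_end u (g :: t) = path_end (opposite u g) t by [].
  set w := opposite u g in bi' nu *; set z := path_end w t => zf pf nd.
  have nzu : z != u by apply: contraNneq nu => <-; apply: path_end_mem.
  (* By properness such an [f] would be [g] itself; then [t] is empty, and the colour due next is
     [d] rather than [c]. *)
  have colour_z y : y \in ends f -> y \in ends g -> phi f = Some c -> False.
    move=> yf yg pfc; have E := proper_inj P yf yg pfc pg.
    have zw : z = w.
      by move: zf; rewrite E (ends_opposite ug) !inE (negbTE nzu) => /eqP.
    have t0 : t = [::] by apply: is_path_end_start zw; case/andP: bi'.
    by move: pf; rewrite t0 /= pfc => -[E']; rewrite E' eqxx in ncd.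
  have pf' : phi f = Some (if odd (size t) then c else d).
    by rewrite pf /=; case: odd.
  rewrite inE negb_or; apply/andP; split; last first.
    apply: IH bi' zf pf' _; first by rewrite eq_sym.
    by case=> wf pfc; apply: (colour_z w); rewrite // opposite_in.
  apply/eqP=> E; have uf : u \in ends f by rewrite -E opposite_in.
  move: pf' nd; case: odd => pf' nd; first exact: (colour_z u).
  exact: nd.
have := mx f; rewrite bichromatic_rcons bi zf pf eqxx andbT /=.
by case/negP; apply: fresh pf _ => // -[vf pfb]; apply: bv pfb.
Qed.

(** A converse to [maxpath_avail], used to certify that reversed paths are maximal. *)
Lemma avail_maxpath phi v a b s : bichromatic_path phi v a b s ->
  (if odd (size s) then b else a) \in avail phi (path_end v s) ->
  is_maxpath phi v a b s.
Proof.
move=> bi /availP av; split=> // f; apply/negP.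
by rewrite bichromatic_rcons => /and4P[_ zf _ /eqP]; apply: av.
Qed.

(** * Counting available colours *)

Lemma card_tavail phi z :
  minn k (deg z + maxmult z) <= #|tavail phi z| + coldeg phi z.
Proof.
rewrite -card_upto -(cardsID (avail phi z)) setIC leq_add2l.
rewrite -(card_imset _ (@Some_inj _)).
apply: leq_trans (leq_imset_card phi _); apply: subset_leq_card.
apply/subsetP=> _ /imsetP[c + ->]; rewrite inE => /andP[/not_availP[f zf pf] _].
by rewrite -pf; apply: imset_f; rewrite inE zf pf.
Qed.

(** The uncoloured edge [f] makes [coldeg phi z] smaller than [deg z], which is at most
    [minn k (deg z + maxmult z)]; so [card_tavail] leaves a colour over. *)
Lemma tavail_exists phi z f : deg z <= k -> z \in ends f -> phi f = None ->
  exists c, c \in tavail phi z.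
Proof.
move=> zk zf pf; apply/set0Pn; rewrite -card_gt0.
have : coldeg phi z < deg z.
  apply: leq_trans (card_incident z); apply: proper_card.
  rewrite properE; apply/andP; split.
    by apply/subsetP=> g; rewrite !inE => /andP[].
  by apply/subsetPn; exists f; rewrite !inE zf ?pf.
rewrite lt0n; apply: contraTN => /eqP t0; rewrite -leqNgt.
apply: leq_trans (_ : minn k (deg z + maxmult z) <= _).
  by rewrite leq_min zk leq_addr.
by have := card_tavail phi z; rewrite t0.
Qed.

(** * Multi-fans *)

Section Fan.
Variables (phi : colouring G k) (x : vertex G) (e : edge G).
Variable F : seq (edge G * vertex G).
Hypotheses (P : proper_colouring phi) (phi_e : phi e = None).
Hypothesis fanF : multifan phi x e F.

Local Notation E i := (nth e (unzip1 F) i).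
Local Notation Y i := (nth x (unzip2 F) i).

(** The relation says that [E i] may follow [E j] in a safe fan chain. It is boolean so that chains
    become instances of [path]; index 0 is the uncoloured edge [e]. *)
Definition link j i :=
  (j < i < size F) &&
  [exists c, (phi (E i) == Some c) && (c \in tavail phi (Y j))].

Definition fan_chain (s : seq nat) := [seq E j | j <- 0 :: s].

Lemma fan_head : 0 < size F /\ E 0 = e.
Proof. by case: fanF => []; case: (F) => //= p F' [->]. Qed.

Lemma fan_ends i : i < size F -> ends (E i) = [set x; Y i].
Proof.
move=> iF; case: fanF => _ _ H _; apply: H.
have -> : (E i, Y i) = nth (e, x) F i.
  by rewrite !(nth_map (e, x)) //; case: nth.
exact: mem_nth.
Qed.

Lemma fan_vertex_neq i : i < size F -> Y i != x.
Proof. by move=> /fan_ends/ends_neq; rewrite eq_sym. Qed.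

Lemma fan_edge_inj i j : i < size F -> j < size F -> E i = E j -> i = j.
Proof.
case: fanF => _ U _ _ iF jF /eqP; rewrite nth_uniq ?size_map //.
by move/eqP.
Qed.

Lemma x_in_fan i : i < size F -> x \in ends (E i).
Proof. by move/fan_ends->; rewrite !inE eqxx. Qed.

Lemma linkP j i : link j i -> exists c,
  [/\ j < i, i < size F, phi (E i) = Some c & c \in tavail phi (Y j)].
Proof.
by case/andP=> /andP[ji iF] /existsP[c /andP[/eqP pc cj]]; exists c.
Qed.

(** Strong induction: the fan condition supplies a smaller index linked to [i], down to 0. *)
Lemma fan_path i : i < size F -> exists2 s, path link 0 s & last 0 s = i.
Proof.
elim/ltn_ind: i => -[|i] IH iF; first by exists [::].
case: fanF => _ _ _ /(_ i.+1 iF)[j [c [ji pc cj]]].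
have [s sp sj] := IH j ji (ltn_trans ji iF).
exists (rcons s i.+1); last by rewrite last_rcons.
rewrite rcons_path sp sj /link ji iF /=.
by apply/existsP; exists c; rewrite pc eqxx.
Qed.

Lemma link_path_le (h : nat) (s : seq nat) : path link h s -> {in h :: s, forall i, i <= last h s}.
Proof.
elim: s h => [|i s IH] h /=; first by move=> _ i; rewrite inE => /eqP->.
case/andP=> /linkP[c [hi _ _ _]] /IH{}IH j; rewrite inE => /orP[/eqP->|/IH//].
by apply: leq_trans (ltnW hi) (IH _ (mem_head _ _)).
Qed.

Lemma link_path_lt (s : seq nat) : path link 0 s -> {in 0 :: s, forall i, i < size F}.
Proof.
have [F0 _] := fan_head; elim: s 0 F0 => [|i s IH] h hF /=.
  by move=> _ j; rewrite inE => /eqP->.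
case/andP=> /linkP[c [_ iF _ _]] /(IH _ iF){}IH j.
by rewrite inE => /orP[/eqP->|/IH].
Qed.

Lemma fan_chain_rcons (s : seq nat) :
  fan_chain s = rcons [seq E j | j <- belast 0 s] (E (last 0 s)).
Proof. by rewrite /fan_chain lastI map_rcons. Qed.

(** A colour on a chain edge after the shift comes from the next chain edge, and the link between
    the two makes it available at the outer end of the former. *)
Lemma fan_shift (s : seq nat) f c : path link 0 s -> f \in fan_chain s ->
  shift phi (fan_chain s) f = Some c -> exists j i,
  [/\ f = E j, i <= last 0 s, i < size F, phi (E i) = Some c
    & j < i /\ c \in tavail phi (Y j)].
Proof.
move=> sp fC; rewrite ffunE fC; set n := index f _.
have sz : size (fan_chain s) = (size s).+1 by rewrite size_map.
have n_lt : n < (size s).+1 by rewrite -sz index_mem.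
have [le|lt] := leqP (size s) n; first by rewrite nth_default // !size_map /= ltnS.
rewrite -map_comp (nth_map 0) //= => pc.
have /linkP[d [ji iF pd dj]] := pathP 0 sp n lt.
exists (nth 0 (0 :: s) n), (nth 0 s n); split=> //.
- by rewrite -(nth_index e fC) (nth_map 0).
- by apply: (link_path_le sp); rewrite inE mem_nth ?orbT.
by split=> //; move: dj; move: pd; rewrite pc => -[->].
Qed.

(** A colour missing at [x] lies on no fan edge, so the shift moves it nowhere. *)
Lemma fan_avail_x (s : seq nat) d z : path link 0 s ->
  d \in avail phi x -> d \in avail phi z ->
  d \in avail (shift phi (fan_chain s)) z.
Proof.
move=> sp /availP dx /availP dz; apply/availP=> f zf.
have [fC|nfC] := boolP (f \in fan_chain s); last by rewrite shift_out //; apply: dz.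
move=> /(fan_shift sp fC)[j [i [_ _ iF pi _]]].
exact: (dx (E i) (x_in_fan iF)).
Qed.

(** The colour [d] can be lost at [z] only if a chain edge from [x] to [z] receives it, and by
    [fan_shift] its index would violate the last hypothesis. *)
Lemma fan_avail (s : seq nat) d z : path link 0 s -> z != x -> d \in avail phi z ->
  (forall j, j < last 0 s -> j < size F -> d \in tavail phi (Y j) -> Y j != z) ->
  d \in avail (shift phi (fan_chain s)) z.
Proof.
move=> sp zx /availP dz H; apply/availP=> f zf.
have [fC|nfC] := boolP (f \in fan_chain s); last by rewrite shift_out //; apply: dz.
move=> /(fan_shift sp fC)[j [i [Ef il iF pi [ji dj]]]].
have jF := ltn_trans ji iF.
have /negP := H j (leq_trans ji il) jF dj; apply.
by move: zf; rewrite Ef fan_ends // !inE (negbTE zx) eq_sym.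
Qed.

Lemma fan_safe (s : seq nat) : path link 0 s -> safe phi (fan_chain s).
Proof.
elim/last_ind: s => [|s i IH].
  by move=> _; rewrite /fan_chain /=; have [_ ->] := fan_head; apply: safe1.
rewrite rcons_path => /andP[sp /linkP[c [li iF pi cl]]].
have -> : fan_chain (rcons s i) = rcons (fan_chain s) (E i).
  by rewrite /fan_chain -rcons_cons map_rcons.
move: (IH sp) (@fan_shift s); rewrite fan_chain_rcons => S shiftE.
have lF := ltn_trans li iF.
have mem_chain f : f \in rcons [seq E j | j <- belast 0 s] (E (last 0 s)) ->
    exists2 j, j < i & j < size F /\ f = E j.
  rewrite -fan_chain_rcons => /mapP[j js ->]; have jl := link_path_le sp js.
  by exists j; [apply: leq_ltn_trans li|split=> //; apply: leq_ltn_trans lF].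
(* The colour [c] is missing at [Y (last 0 s)] but present at [Y i] on [E i]. Hence the two edges
   share only [x], even though the fan may contain parallel edges. *)
have nY : Y i != Y (last 0 s).
  apply/eqP=> EY; case/tavailP: cl => /availP/(_ (E i)) + _.
  by rewrite fan_ends // EY !inE eqxx orbT => /(_ isT).
have Yx := fan_vertex_neq lF.
apply/safe_rcons; split=> //.
- by apply/negP=> /mem_chain[j ji [jF /(fan_edge_inj iF jF) Eij]]; rewrite Eij ltnn in ji.
- by rewrite pi.
- apply/eqP/cards1P; exists x; apply/setP=> z; rewrite !fan_ends // !inE.
  case: eqVneq => //= _; case: eqVneq => //= ->.
  by rewrite eq_sym; apply/negbTE.
exists (Y (last 0 s)), c; split.
- by rewrite fan_ends // !inE eqxx orbT.
- by rewrite fan_ends // !inE negb_or Yx eq_sym.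
- rewrite shift_out //; apply/negP=> /mem_chain[j ji [jF /(fan_edge_inj iF jF) Eij]].
  by rewrite Eij ltnn in ji.
(* The shift brings no [c] to [Y (last 0 s)]: the source would be an earlier fan edge of colour [c],
   which by properness at [x] is [E i]. *)
case/tavailP: cl => /availP cl c_l; apply/tavailP; split=> //; apply/availP=> f zf.
have [fC|nfC] := boolP (f \in rcons [seq E j | j <- belast 0 s] (E (last 0 s))); last first.
  by rewrite shift_out //; apply: cl.
move=> /(shiftE _ _ sp fC)[j [i' [_ il i'F pi' _]]].
have /(fan_edge_inj i'F iF) Ei := proper_inj P (x_in_fan i'F) (x_in_fan iF) pi' pi.
by move: il; rewrite Ei leqNgt li.
Qed.

(** * Multi-fans in the absence of improving Vizing chains *)

Section NoImproving.
Hypotheses (k_gt1 : 1 < k) (L : local_colouring phi).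
Hypothesis no_improving : ~ exists C : seq (edge G), vizing phi C /\ improving phi C.

(** All edges of a fan chain contain [x], and the path starts at the outer end of the last one, so
    the concatenation is a Vizing chain. *)
Lemma fan_vizing (s : seq nat) a b (t : seq (edge G)) n : path link 0 s -> a != b ->
  bichromatic_path phi (Y (last 0 s)) a b t ->
  ~ improving phi (fan_chain s ++ take n t).
Proof.
move=> sp nab bi imp; apply: no_improving; exists (fan_chain s ++ take n t).
split=> //; split; first by case: imp => [[]].
exists x, [seq E j | j <- belast 0 s], (E (last 0 s)), (take n t).
rewrite -fan_chain_rcons; split=> //.
  by move=> f /mapP[j /(link_path_lt sp) jF ->]; apply: x_in_fan.
exists a, b, t; split=> //; last by apply/prefixP; exists (drop n t); rewrite cat_take_drop.
by rewrite (opposite_ends (fan_ends _)) // (link_path_lt sp) // mem_last.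
Qed.

(** A common missing colour survives the shift along the fan chain to [E i]; within the bound, it
    could then be given to [E i]. *)
Lemma fan_avail_disjoint i c : i < size F -> c \in avail phi x ->
  c \in avail phi (Y i) ->
  c \notin upto k (maxn (deg x + maxmult x) (deg (Y i) + maxmult (Y i))).
Proof.
move=> iF cx ci; apply/negP=> c_max; have [s sp si] := fan_path iF.
have k0 : 0 < k by apply: ltnW.
(* The bichromatic part is empty, but its definition still asks for two distinct colours; [k >= 2]
   provides them. *)
have nab : Ordinal k0 != Ordinal k_gt1 by [].
apply: (@fan_vizing s _ _ [::] 0 sp nab) => //; rewrite [take _ _]/= cats0.
have := fan_safe sp; have := fan_avail_x sp cx cx; have := fan_avail_x sp cx ci.
rewrite fan_chain_rcons si => ci' cx' S.
exact: (improving_colour P L S (fan_ends iF) cx' ci' c_max).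
Qed.

(* The fan chain to [Y i] does not disturb the path from [Y i]: an edge that
   receives the colour [b] joins [x] to some [Y j] with [j < i] and [b] missing
   at [Y j], and the path from [Y j] ends at [x] by induction. *)
Lemma fan_maxpath i a b (t : seq (edge G)) : i < size F ->
  a \in tavail phi x -> b \in tavail phi (Y i) ->
  is_maxpath phi (Y i) a b t -> path_end (Y i) t = x.
Proof.
move=> iF ax; elim/ltn_ind: i iF t => i IH iF t bi mx; apply/eqP/negP=> /negP nex.
have [/[dup] bia /availP av_a a_x] := tavailP _ _ _ ax.
have [av_b b_i] := tavailP _ _ _ bi.
have nab : a != b.
  apply/eqP=> eab; have := fan_avail_disjoint iF bia; rewrite eab => /(_ av_b)/negP; apply.
  by move: a_x; rewrite eab !inE leq_max => ->.
have nYx := fan_vertex_neq iF.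
have [bip _] := mx.
(* The vertex [x] is neither end of the path, and it is not interior because [a] is missing
   there. *)
have out : x \notin Y i :: scanl (@opposite G) (Y i) t.
  apply/negP=> xt; rewrite eq_sym in nYx; rewrite eq_sym in nex.
  by have [] := interior_not_avail bip xt nYx nex; rewrite bia.
have end_av := maxpath_avail P nab av_b mx.
have [s sp si] := fan_path iF.
have IH' j : j < last 0 s -> j < size F -> b \in tavail phi (Y j) -> Y j != Y i.
  rewrite si => ji jF bj; apply/eqP=> EY; case/eqP: nex.
  by rewrite -EY; apply: IH ji jF _ bj _; rewrite EY.
have [n imp] : exists n, improving phi (fan_chain s ++ take n t); last first.
  by have := @fan_vizing s a b t n sp nab; rewrite si => /(_ bip imp).
have S := fan_safe sp.
have avx := fan_avail_x sp bia bia.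
have avi := fan_avail sp nYx av_b IH'.
have ave : (if odd (size t) then b else a) \in
    avail (shift phi (fan_chain s)) (path_end (Y i) t).
  case: ifP end_av => odd_t end_av; last exact: fan_avail_x.
  apply: fan_avail => // j; rewrite si => ji jF bj; apply/eqP=> EY.
  (* With odd length, the reversed path from [Y j] also starts with [a], and it is maximal since [b]
     is missing at [Y i]. By induction it would end at [x], yet it ends at [Y i]. *)
  have := IH j ji jF (rev t) bj; rewrite EY => H.
  have W : walk (Y i) t by case/andP: bip => /andP[].
  have [_ [Erev _]] := path_end_rev W.
  case/eqP: nYx; rewrite -Erev; apply: H.
  apply: avail_maxpath; first by have := bichromatic_rev bip; rewrite odd_t.
  by rewrite size_rev odd_t Erev.
have outC : {in t, forall f, f \notin fan_chain s}.
  move=> f ft; apply/negP=> /mapP[j /(link_path_lt sp) jF Ef].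
  case/negP: out; have /andP[/andP[W _] _] := bip.
  by apply: mem_walk W ft _; rewrite Ef x_in_fan.
move: S avx avi ave outC; rewrite fan_chain_rcons si => S avx avi ave outC.
apply: (kempe_improving P L S (fan_ends iF) nab bip outC out) => //.
  exact/tavailP.
exact/tavailP.
Qed.

Hypothesis deg_le : forall v : vertex G, deg v <= k.
Hypothesis x_e : x \in ends e.

Lemma fan_tavail_disjoint i j c : i < size F -> j < size F -> Y i != Y j ->
  c \in tavail phi (Y i) -> c \notin tavail phi (Y j).
Proof.
move=> iF jF nij ci; apply/negP=> cj.
(* Any colour available at [x] serves for comparing the two paths; the uncoloured edge [e]
   guarantees one. *)
have [a ax] := tavail_exists (deg_le x) x_e phi_e.
have [a_av a_x] := tavailP _ _ _ ax.
have rev_max n t : n < size F -> c \in tavail phi (Y n) ->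
    is_maxpath phi (Y n) a c t ->
    is_maxpath phi x c a (rev t) /\ path_end x (rev t) = Y n.
  move=> nF cn mx; have Et := fan_maxpath nF ax cn mx.
  have [bi _] := mx; have [c_av _] := tavailP _ _ _ cn.
  have W : walk (Y n) t by case/andP: bi => /andP[].
  have [_ [Erev _]] := path_end_rev W; rewrite Et in Erev.
  (* The path ends at [x], where [a] is missing, so its last edge cannot have colour [a]. Hence the
     reversed path starts with [c], whatever [n] is. *)
  have odd_t : odd (size t) = false.
    apply/negP=> odd_t; move: bi (bichromatic_rev bi); rewrite odd_t Et.
    case: (lastP t) W Et odd_t => [//|t' f] W Et odd_t _.
    rewrite rev_rcons bichromatic_cons => /and4P[xf /eqP pf _ _].
    by move/availP: a_av => /(_ f xf).
  split=> //; apply: avail_maxpath; last by rewrite size_rev odd_t Erev.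
  by have := bichromatic_rev bi; rewrite odd_t Et.
have [s mxs] := is_maxpath_exists phi (Y i) a c.
have [t mxt] := is_maxpath_exists phi (Y j) a c.
have [mxs' Es] := rev_max _ _ iF ci mxs; have [mxt' Et] := rev_max _ _ jF cj mxt.
by case/eqP: nij; rewrite -Es -Et (is_maxpath_unique P mxs' mxt').
Qed.

(** * Maximal multi-fans *)

Section Maximal.
Hypothesis maxF : forall F', multifan phi x e F' -> prefix F F' -> F' = F.

(** By [fan_avail_disjoint] the colour [c] is present at [x]. An edge of that colour outside the fan
    could be appended, and it is not the first edge, which is uncoloured. *)
Lemma maximal_fan_edge i c : i < size F -> c \in tavail phi (Y i) ->
  exists n, [/\ 0 < n, n < size F & phi (E n) = Some c].
Proof.
move=> iF ci; have [c_av c_i] := tavailP _ _ _ ci.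
have /not_availP[f xf pf] : c \notin avail phi x.
  apply/negP=> cx; case/negP: (fan_avail_disjoint iF cx c_av).
  by move: c_i; rewrite !inE leq_max orbC => ->.
have [fF|nfF] := boolP (f \in unzip1 F).
  exists (index f (unzip1 F)); rewrite nth_index //.
  have := fF; rewrite -index_mem size_map => ->; split=> //.
  rewrite lt0n; apply/negP=> /eqP E0; have [_ Ee] := fan_head.
  by move: (nth_index e fF); rewrite E0 Ee => Ef; rewrite -Ef phi_e in pf.
have : rcons F (f, opposite x f) = F.
  apply: maxF; last by rewrite -cats1 prefix_prefix.
  have [hd U Hends Hlink] := fanF.
  split.
  - by rewrite /unzip1 map_rcons; case: (F) hd.
  - by rewrite /unzip1 map_rcons rcons_uniq nfF.
  - move=> g y; rewrite mem_rcons inE => /orP[/eqP[-> ->]|]; last exact: Hends.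
    exact: ends_opposite.
  move=> n; rewrite size_rcons ltnS => /andP[n0].
  rewrite /unzip1 /unzip2 !map_rcons leq_eqVlt => /orP[/eqP->|nF].
    exists i, c; rewrite !nth_rcons !size_map ltnn eqxx iF; split=> //.
  have [j [d [jn pd dj]]] := Hlink n (introT andP (conj n0 nF)).
  exists j, d; rewrite !nth_rcons !size_map nF (ltn_trans jn nF); split=> //.
by move/(congr1 size)/eqP; rewrite size_rcons eqn_leq ltnn.
Qed.

Lemma mem_fan_vertices z :
  reflect (exists2 i, i < size F & z = Y i) (z \in fan_vertices F).
Proof.
rewrite inE; apply: (iffP (nthP x)) => -[i]; rewrite size_map.
  by move=> iF <-; exists i.
by move=> iF ->; exists i; rewrite ?size_map.
Qed.

(** Some colour is available at [Y 0] because [e] is uncoloured. It occurs on a fan edge, whose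
    outer end must then differ from [Y 0]. *)
Lemma maximal_fan_vertices : 2 <= #|fan_vertices F|.
Proof.
have [F0 Ee] := fan_head; have Y0e : Y 0 \in ends e.
  by rewrite -[e in ends e]Ee fan_ends // !inE eqxx orbT.
have [c c0] := tavail_exists (deg_le _) Y0e phi_e.
have [n [_ nF pn]] := maximal_fan_edge F0 c0.
have nY : Y 0 != Y n.
  apply/eqP=> EY; case/tavailP: c0 => /availP/(_ (E n)) + _.
  by rewrite EY fan_ends // !inE eqxx orbT => /(_ isT).
have <- : #|[set Y 0; Y n]| = 2 by rewrite cards2 nY.
apply/subset_leq_card/subsetP=> z; rewrite in_set2 => /orP[]/eqP->.
  by apply/mem_fan_vertices; exists 0.
by apply/mem_fan_vertices; exists n.
Qed.

Lemma sum_fan_tavail : \sum_(z in fan_vertices F) #|tavail phi z| < size F.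
Proof.
have [F0 Ee] := fan_head.
pose used := [set c | [exists z in fan_vertices F, c \in tavail phi z]].
apply: (@leq_ltn_trans #|used|).
  (* Double counting of pairs of a fan vertex and a colour available there: by disjointness each
     colour in [used] contributes at most one. *)
  rewrite -sum1_card.
  under eq_bigr => z _ do rewrite -sum1_card big_mkcond.
  rewrite exchange_big [leqRHS]big_mkcond; apply: leq_sum => c _ /=.
  rewrite -big_mkcondr sum1_card.
  case: ifP => [_|/negbT nc].
    apply/card_le1_eqP=> z z'; rewrite !unfold_in.
    case/andP=> /mem_fan_vertices[i iF ->] ci /andP[/mem_fan_vertices[j jF ->] cj].
    apply/eqP/negP=> /negP nij.
    by case/negP: (fan_tavail_disjoint jF iF nij cj).
  rewrite leqn0; apply/eqP/eq_card0 => z; rewrite unfold_in.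
  apply/negP=> /andP[zV cz]; case/negP: nc; rewrite inE.
  by apply/existsP; exists z; rewrite zV.
have -> : #|used| = #|Some @: used| by rewrite card_imset //; apply: Some_inj.
(* Dropping the head of the fan removes the uncoloured edge [e], which makes the final inequality
   strict. *)
suff /subset_leq_card le : Some @: used \subset [seq phi f | f <- behead (unzip1 F)].
  apply: leq_ltn_trans le _; apply: leq_ltn_trans (card_size _) _.
  by rewrite size_map size_behead size_map prednK.
apply/subsetP=> _ /imsetP[c + ->]; rewrite inE => /existsP[z /andP[]].
move=> /mem_fan_vertices[i iF ->] /(maximal_fan_edge iF)[n [n0 nF <-]].
apply: map_f; rewrite -(prednK n0) -nth_behead; apply: mem_nth.
by rewrite size_behead size_map -ltnS (prednK n0) (prednK F0).
Qed.

Lemma sum_fan_count :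
  \sum_(z in fan_vertices F) count_mem z (unzip2 F) = size F.
Proof.
under eq_bigr => z _ do rewrite -sum1_count big_mkcond /=.
rewrite exchange_big /= -(size_map snd) -sum1_size big_seq [RHS]big_seq.
apply: eq_bigr => y yF; rewrite (bigD1 y) ?inE //= eqxx big1 // => z /andP[_ nzy].
by rewrite eq_sym (negbTE nzy).
Qed.

(** The inequality of part (e) with the subtracted terms moved across, so that it lives in the
    natural numbers. It adds [card_tavail], summed over the fan vertices, to [sum_fan_tavail]. *)
Lemma maximal_fan_sum :
  \sum_(z in fan_vertices F) minn k (deg z + maxmult z) <
  \sum_(z in fan_vertices F) count_mem z (unzip2 F) +
  \sum_(z in fan_vertices F) coldeg phi z.
Proof.
rewrite sum_fan_count.
have := sum_fan_tavail; rewrite -(ltn_add2r (\sum_(z in fan_vertices F) coldeg phi z)).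
by apply: leq_ltn_trans; rewrite -big_split; apply: leq_sum => z _; apply: card_tavail.
Qed.

End Maximal.
End NoImproving.
End Fan.
End Colourings.

Theorem theorem3p1 (k : nat) (hk : 2 <= k) (G : multigraph)
    (hdeg : forall v : vertex G, deg v <= k)
    (phi : colouring G k)
    (hproper : proper_colouring phi) (hlocal : local_colouring phi)
    (hvizing : ~ exists C : seq (edge G), vizing phi C /\ improving phi C)
    (e : edge G) (he : phi e = None) (x : vertex G) (hx : x \in ends e)
    (F : seq (edge G * vertex G)) (hF : multifan phi x e F) :
  let y (i : nat) : vertex G := nth x (unzip2 F) i in
  [/\ forall i : nat, i < size F ->
        exists s : seq nat,
          [/\ path ltn 0 s, last 0 s = i
            & safe phi [seq nth e (unzip1 F) j | j <- 0 :: s]],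
      forall i : nat, i < size F ->
        avail phi x :&: avail phi (y i)
          :&: upto k (maxn (deg x + maxmult x) (deg (y i) + maxmult (y i)))
        = set0,
      forall (i : nat) (alpha beta : 'I_k), i < size F ->
        alpha \in tavail phi x -> beta \in tavail phi (y i) ->
        exists P : seq (edge G),
          is_maxpath phi (y i) alpha beta P /\ path_end (y i) P = x,
      forall i j : nat, i < size F -> j < size F -> y i <> y j ->
        tavail phi (y i) :&: tavail phi (y j) = set0
    & maximal_multifan phi x e F ->
        2 <= #|fan_vertices F| /\
        (1 <= \sum_(z in fan_vertices F)
                ((count_mem z (unzip2 F))%:Z
                 - (minn k (deg z + maxmult z))%:Z
                 + (coldeg phi z)%:Z) :> int)%R].
Proof.
move=> y; split.
- move=> i iF; have [s sp si] := fan_path hF iF; exists s; split=> //.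
    by apply: sub_path sp => j n /linkP[c []].
  exact: (fan_safe hproper he hF sp).
- move=> i iF; apply/setP=> c; rewrite in_set0 !in_setI; apply/negP.
  case/andP=> /andP[cx ci]; apply/negP.
  exact: (fan_avail_disjoint hproper he hF hk hlocal hvizing).
- move=> i a b iF ax bi; have [t mx] := is_maxpath_exists phi (y i) a b.
  exists t; split=> //.
  exact: (fan_maxpath hproper he hF hk hlocal hvizing iF ax bi mx).
- move=> i j iF jF /eqP nij; apply/setP=> c; rewrite in_set0 in_setI; apply/negP.
  case/andP=> ci; apply/negP.
  exact: (fan_tavail_disjoint hproper he hF hk hlocal hvizing hdeg hx iF jF nij ci).
case=> _ maxF; split.
  exact: (maximal_fan_vertices hproper he hF hk hlocal hvizing hdeg maxF).
have := maximal_fan_sum hproper he hF hk hlocal hvizing hdeg hx maxF.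
(* The integer sum splits into three, and the embedding [Posz] is pulled out of each, which reduces
   the goal to [maximal_fan_sum]. *)
rewrite big_split GRing.sumrB /= -!(big_morph Posz PoszD (erefl _)).
lia.
Qed.
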